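(* Let $(p_n)_{n\in\mathbb{N}}$ and $(q_n)_{n\in\mathbb{N}}$ be two real sequences, $\mathbf{p}=[p_0,p_1,\ldots]$, $\mathbf{q}=[q_0,q_1,\ldots]$. Let $\gamma\neq 0$ be a real number, and for $t>0$ let $\mathbf{a}(t)=[a_0(t),a_1(t),\ldots]$ with $a_n(t)=n!/t^{n+1}$, $n\in\mathbb{N}$. Assume that for all $t>0$ with $t>|\gamma|$ the Taylor integrals $I_{\gamma,\mathbf{a}(t)}^{\mathbf{p},\mathbb{N}}$ and $I_{\gamma,\mathbf{a}(t)}^{\mathbf{q},\mathbb{N}}$ exist, are finite, and satisfy $$I_{\gamma,\mathbf{a}(t)}^{\mathbf{p},\mathbb{N}}=I_{\gamma,\mathbf{a}(t)}^{\mathbf{q},\mathbb{N}}.$$ Then $p_n=q_n$ for all $n\in\mathbb{N}$.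
   Context: $\mathbb{N}=\{0,1,2,\ldots\}$. For a real number $\gamma$, real sequences $\mathbf{a}=(a_0,a_1,\ldots)$ and $\mathbf{s}=(s_0,s_1,\ldots)$, the Taylor integral of $\mathbf{s}$ with respect to the Taylor measure $T_{\gamma,\mathbf{a}}(B)=\sum_{n\in B}a_n\frac{\gamma^n}{n!}$ over $\mathbb{N}$ is $$I_{\gamma,\mathbf{a}}^{\mathbf{s},\mathbb{N}}=\sum_{n\in\mathbb{N}}s_n a_n\frac{\gamma^n}{n!},$$ and it is finite when this series converges to a finite value. In particular, for $a_n(t)=n!/t^{n+1}$, one has $I_{\gamma,\mathbf{a}(t)}^{\mathbf{s},\mathbb{N}}=\frac1t\sum_{n\in\mathbb{N}}s_n(\gamma/t)^n$. *)

(* Defs.v *)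
From Stdlib Require Import Reals Factorial.
From Coquelicot Require Import Coquelicot.
Open Scope R_scope.

(* T_{gamma,a}({n}), the mass which the Taylor measure gives to the atom n. *)
Definition taylor_mass (gamma : R) (a : nat -> R) (n : nat) : R :=
  a n * (gamma ^ n / INR (fact n)).

(* The integral over N exists and is finite when the series converges in R;
   absolute convergence is not required. *)
Definition taylor_integral_finite (gamma : R) (a s : nat -> R) : Prop :=
  ex_series (fun n => s n * taylor_mass gamma a n).

(* Series is total: the value is meaningful only under
   taylor_integral_finite. *)
Definition taylor_integral (gamma : R) (a s : nat -> R) : R :=
  Series (fun n => s n * taylor_mass gamma a n).

(* The n-th weight is the Laplace transform at t of x ^ n. *)
Definition laplace_weights (t : R) (n : nat) : R := INR (fact n) / t ^ (n + 1).

(* Main.v *)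
Require Import Defs.
From Stdlib Require Import Reals Lra.
From Coquelicot Require Import Coquelicot.
Open Scope R_scope.

(** For the weights [n! / t^(n+1)] the factorials cancel, and the Taylor
    integral of [s] is [1/t] times the power series of [s] at [gamma / t].  As
    [t] runs over the reals above [|gamma|], the point [gamma / t] takes
    arbitrarily small nonzero values, all of the sign of [gamma].  So equality
    of the integrals says that the power series with coefficients [p n - q n]
    vanishes along a sequence of nonzero points tending to [0].

    Such a series is zero ([pseries_coef_eq0]): it converges at a nonzero
    point, hence has positive radius of convergence and is continuous at [0],
    where its value, the constant coefficient, must be the limit [0] of its
    values along the sequence.  Dividing the series by the variable gives a
    series which vanishes at the same points, because these are nonzero, and
    the argument applies to the next coefficient. *)

(** Outside the disk of convergence the terms do not even tend to [0]. *)
Lemma CV_radius_ge_ex_pseries (a : nat -> R) (x : R) :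
  ex_pseries a x -> Rbar_le (Rabs x) (CV_radius a).
Proof.
  intros Hx; apply Rbar_not_lt_le; intros Hlt.
  apply (CV_disk_outside a x Hlt), ex_series_lim_0.
  now apply ex_pseries_R.
Qed.

(** The value of the series at [0] is its constant coefficient, and continuity
    at [0] identifies it with the limit along [u]. *)
Lemma pseries_coef0_eq0 (a u : nat -> R) :
  is_lim_seq u 0 -> Rbar_lt 0 (CV_radius a) ->
  (forall k, PSeries a (u k) = 0) -> a 0%nat = 0.
Proof.
  intros Hu Hr H0.
  assert (Hlim : is_lim_seq (fun k => PSeries a (u k)) (PSeries a 0)).
  { apply is_lim_seq_continuous; [| exact Hu].
    apply PSeries_continuity; now rewrite Rabs_R0. }
  apply is_lim_seq_unique in Hlim.
  rewrite (Lim_seq_ext _ _ H0), Lim_seq_const, PSeries_0 in Hlim.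
  now injection Hlim.
Qed.

(** Identity theorem at [0].  The induction replaces the series [a] by
    [PS_decr_1 a], its quotient by the variable once the constant coefficient
    is known to be [0]; the hypotheses on [u] pass to the quotient. *)
Lemma pseries_coef_eq0 (a u : nat -> R) :
  is_lim_seq u 0 -> (forall k, u k <> 0) ->
  (forall k, ex_pseries a (u k)) -> (forall k, PSeries a (u k) = 0) ->
  forall n, a n = 0.
Proof.
  intros Hu Hne Hex H0 n; revert a Hex H0.
  assert (Hbase : forall a, (forall k, ex_pseries a (u k)) ->
            (forall k, PSeries a (u k) = 0) -> a 0%nat = 0).
  { intros a Hex; apply pseries_coef0_eq0; [exact Hu |].
    apply Rbar_lt_le_trans with (Rabs (u 0%nat)).
    - apply Rabs_pos_lt, Hne.
    - apply CV_radius_ge_ex_pseries, Hex. }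
  induction n as [|n IH]; intros a Hex H0; [now apply Hbase |].
  pose proof (Hbase a Hex H0) as Ha0.
  apply (IH (PS_decr_1 a)); intros k.
  - apply ex_pseries_decr_1; [| apply Hex].
    right; exists (/ u k); apply Rinv_l, Hne.
  - specialize (H0 k); rewrite (PSeries_decr_1 _ _ (Hex k)), Ha0 in H0.
    rewrite Rplus_0_l in H0.
    apply Rmult_integral in H0 as [H | H]; [now elim (Hne k) | exact H].
Qed.

Lemma laplace_taylor_term (gamma t s : R) (n : nat) : t <> 0 ->
  s * taylor_mass gamma (laplace_weights t) n = / t * (s * (gamma / t) ^ n).
Proof.
  intros Ht; unfold taylor_mass, laplace_weights, Rdiv.
  rewrite Rpow_mult_distr, pow_inv, pow_add, pow_1.
  field; repeat split; try apply INR_fact_neq_0; try apply pow_nonzero; exact Ht.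
Qed.

Lemma laplace_taylor_integral (gamma t : R) (s : nat -> R) : t <> 0 ->
  taylor_integral gamma (laplace_weights t) s = / t * PSeries s (gamma / t).
Proof.
  intros Ht; unfold taylor_integral, PSeries.
  rewrite <- Series_scal_l.
  apply Series_ext; intros n; now apply laplace_taylor_term.
Qed.

Lemma laplace_taylor_integral_finite (gamma t : R) (s : nat -> R) : t <> 0 ->
  taylor_integral_finite gamma (laplace_weights t) s ->
  ex_pseries s (gamma / t).
Proof.
  intros Ht Hs; apply ex_pseries_R.
  apply (ex_series_scal_l t) in Hs.
  refine (ex_series_ext _ _ _ Hs); intros n.
  unfold scal; simpl; unfold mult; simpl.
  rewrite laplace_taylor_term by exact Ht.
  now field.
Qed.

Theorem theorem5 (p q : nat -> R) (gamma : R) (hgamma : gamma <> 0)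
  (hI : forall t : R, 0 < t -> Rabs gamma < t ->
    taylor_integral_finite gamma (laplace_weights t) p /\
    taylor_integral_finite gamma (laplace_weights t) q /\
    taylor_integral gamma (laplace_weights t) p =
      taylor_integral gamma (laplace_weights t) q) :
  forall n : nat, p n = q n.
Proof.
  set (t := fun k : nat => Rabs gamma + INR (S k)).
  assert (Hgt : forall k, Rabs gamma < t k).
  { intros k; unfold t; pose proof (lt_0_INR (S k) (Nat.lt_0_succ k)); lra. }
  assert (Hpos : forall k, 0 < t k).
  { intros k; apply Rle_lt_trans with (2 := Hgt k), Rabs_pos. }
  assert (Hne : forall k, t k <> 0) by (intros k; apply Rgt_not_eq, Hpos).
  assert (Hlim : is_lim_seq (fun k => gamma / t k) 0).
  { replace (Finite 0) with (Rbar_mult gamma (Rbar_inv p_infty))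
      by (simpl; f_equal; ring).
    apply is_lim_seq_scal_l, is_lim_seq_inv; [| discriminate].
    apply is_lim_seq_plus with (Rabs gamma) p_infty;
      [ apply is_lim_seq_const | | reflexivity ].
    apply (is_lim_seq_incr_1 INR), is_lim_seq_INR. }
  assert (Hp : forall k, ex_pseries p (gamma / t k)).
  { intros k; apply laplace_taylor_integral_finite; [apply Hne |].
    apply (hI (t k) (Hpos k) (Hgt k)). }
  assert (Hq : forall k, ex_pseries q (gamma / t k)).
  { intros k; apply laplace_taylor_integral_finite; [apply Hne |].
    apply (hI (t k) (Hpos k) (Hgt k)). }
  intros n; apply Rminus_diag_uniq.
  apply (pseries_coef_eq0 (PS_minus p q) (fun k => gamma / t k) Hlim).
  - intros k; apply Rmult_integral_contrapositive_currified;
      [exact hgamma | apply Rinv_neq_0_compat, Hne].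
  - intros k; now apply ex_pseries_minus.
  - intros k; rewrite PSeries_minus by easy.
    apply Rminus_diag_eq, (Rmult_eq_reg_l (/ t k));
      [| apply Rinv_neq_0_compat, Hne].
    rewrite <- !laplace_taylor_integral by apply Hne.
    apply (hI (t k) (Hpos k) (Hgt k)).
Qed.
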